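(* For every $\alpha$ and $n$ with $3\le\alpha<\omega$ and $n<\omega$ there exists a polyadic-type algebra $\mathcal{A}$ (of dimension $\alpha$) with the following properties. (i) $\mathcal{A}$ is not isomorphic to a member of $Pse_\alpha$. (ii) Each $n$-generated subalgebra of $\mathcal{A}$ is isomorphic to a member of $Pse_\alpha$. (iii) The cylindrification-free, the diagonal-free, and the transposition-free reducts of $\mathcal{A}$ are all isomorphic to subalgebras of the corresponding reducts of members of $Pse_\alpha$.
   Context: A polyadic equality set algebra of dimension $\alpha$ with base set $U$ is an algebra $\langle A,+,-,C^U_i,D^U_{ij},P_{ij}\rangle_{i,j<\alpha}$, where $A$ is a set of subsets of $U^\alpha$ containing the $D^U_{ij}$ and closed under the operations: $+$ is union, $-$ is complement with respect to $U^\alpha$, $C^U_i(X)=\{u\in U^\alpha : \text{there is } u'\in X \text{ with } u_j=u'_j \text{ for all } j\neq i\}$, $D^U_{ij}=\{u\in U^\alpha : u_i=u_j\}$, and $P_{ij}(X)=\{u\in U^\alpha : \text{there is } u'\in X \text{ with } u_i=u'_j,\ u_j=u'_i,\ u_l=u'_l \text{ for all } l\notin\{i,j\}\}$. $Pse_\alpha$ is the class of all of these. A polyadic-type algebra (of dimension $\alpha$) is any algebra $\langle A,+,-,c_i,d_{ij},p_{ij}\rangle_{i,j<\alpha}$ of the same similarity type: $+$ binary, $-,c_i,p_{ij}$ unary, $d_{ij}$ constants. An algebra is $n$-generated if there is a subset $X$ of its universe with $|X|\le n$ such that no proper subset of the universe contains $X$ and is closed under all operations. The cylindrification-free, diagonal-free,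 and transposition-free reducts of $\langle A,+,-,c_i,d_{ij},p_{ij}\rangle_{i,j<\alpha}$ are $\langle A,+,-,d_{ij},p_{ij}\rangle_{i,j<\alpha}$, $\langle A,+,-,c_i,p_{ij}\rangle_{i,j<\alpha}$, and $\langle A,+,-,c_i,d_{ij}\rangle_{i,j<\alpha}$, respectively. *)

(* Defs.v *)
From mathcomp Require Import all_boot.
From mathcomp Require Import boolp classical_sets functions cardinality.
Set Implicit Arguments.
Unset Strict Implicit.
Unset Printing Implicit Defensive.
Local Open Scope classical_set_scope.
Local Open Scope card_scope.

Record signature : Type := Signature {
  op : Type;
  arity : op -> nat }.

Record algebra (S : signature) : Type := Algebra {
  carrier :> Type;
  interp : forall o : op S, (arity o).-tuple carrier -> carrier }.

Arguments interp {S _} o t.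

Section UniversalAlgebra.
Variable S : signature.

Definition op_closed (A : algebra S) (X : set A) : Prop :=
  forall (o : op S) (t : (arity o).-tuple A),
    (forall k, X (tnth t k)) -> X (interp o t).

Lemma closed_interp (A : algebra S) (X : set A) (clX : op_closed X) (o : op S)
  (t : (arity o).-tuple (set_type X)) : interp o (map_tuple val t) \in X.
Proof.
by rewrite inE; apply: clX => k; rewrite tnth_map; apply/set_mem/valP.
Qed.

Definition subalgebra (A : algebra S) (X : set A) (clX : op_closed X) :
    algebra S :=
  @Algebra S (set_type X)
    (fun o t => exist _ (interp o (map_tuple val t)) (closed_interp clX t)).

Definition homomorphism (A B : algebra S) (f : A -> B) : Prop :=
  forall (o : op S) (t : (arity o).-tuple A),
    f (interp o t) = interp o (map_tuple f t).

Definition isomorphic (A B : algebra S) : Prop :=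
  exists2 f : A -> B, bijective f & homomorphism f.

Definition n_generated (n : nat) (A : algebra S) : Prop :=
  exists2 X : set A, X #<= `I_n &
    ~ exists Y : set A, [/\ Y `<` [set: A], X `<=` Y & op_closed Y].

Definition reduct_signature (K : pred (op S)) : signature :=
  {| op := {o : op S | K o}; arity := fun o => arity (val o) |}.

Definition reduct (K : pred (op S)) (A : algebra S) :
    algebra (reduct_signature K) :=
  @Algebra (reduct_signature K) A (fun o t => @interp S A (val o) t).

End UniversalAlgebra.

Inductive polyadic_op (alpha : nat) : Type :=
| Plus
| Minus
| Cyl of 'I_alpha
| Diag of 'I_alpha & 'I_alpha
| Transp of 'I_alpha & 'I_alpha.

Definition polyadic_signature (alpha : nat) : signature :=
  {| op := polyadic_op alpha;
     arity := fun o => match o with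
                       | Plus => 2
                       | Minus | Cyl _ | Transp _ _ => 1
                       | Diag _ _ => 0
                       end |}.

Definition polyadic_type_algebra (alpha : nat) : Type :=
  algebra (polyadic_signature alpha).

Definition cyl_free (alpha : nat) : pred (op (polyadic_signature alpha)) :=
  fun o => if o is Cyl _ then false else true.
Definition diag_free (alpha : nat) : pred (op (polyadic_signature alpha)) :=
  fun o => if o is Diag _ _ then false else true.
Definition transp_free (alpha : nat) : pred (op (polyadic_signature alpha)) :=
  fun o => if o is Transp _ _ then false else true.

Section SetAlgebras.
Variables (alpha : nat) (U : Type).

Definition cyl (i : 'I_alpha) (X : set ('I_alpha -> U)) :
    set ('I_alpha -> U) :=
  [set u | exists2 u', X u' & forall j, j != i -> u j = u' j].

Definition diag (i j : 'I_alpha) : set ('I_alpha -> U) :=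
  [set u | u i = u j].

Definition transp (i j : 'I_alpha) (X : set ('I_alpha -> U)) :
    set ('I_alpha -> U) :=
  [set u | exists2 u', X u' &
     [/\ u i = u' j, u j = u' i &
         forall l, l != i -> l != j -> u l = u' l]].

Definition full_set_algebra : polyadic_type_algebra alpha :=
  @Algebra (polyadic_signature alpha) (set ('I_alpha -> U))
    (fun o => match o with
     | Plus => fun t => tnth t ord0 `|` tnth t ord_max
     | Minus => fun t => ~` tnth t ord0
     | Cyl i => fun t => cyl i (tnth t ord0)
     | Diag i j => fun=> diag i j
     | Transp i j => fun t => transp i j (tnth t ord0)
     end).

End SetAlgebras.

(* The base U may be empty, and the unit is always the full power U^alpha. *)
Record Pse (alpha : nat) : Type := MkPse {
  pse_base : Type;
  pse_universe : set (full_set_algebra alpha pse_base);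
  pse_closed : op_closed pse_universe }.

Definition pse_algebra (alpha : nat) (B : Pse alpha) :
    polyadic_type_algebra alpha :=
  subalgebra (@pse_closed alpha B).

Definition reduct_embeds_in_Pse (alpha : nat)
    (K : pred (op (polyadic_signature alpha)))
    (A : polyadic_type_algebra alpha) : Prop :=
  exists (B : Pse alpha) (Y : set (reduct K (pse_algebra B)))
         (clY : op_closed Y),
    isomorphic (reduct K A) (subalgebra clY).

(* Main.v *)
Require Import Defs.
From mathcomp Require Import all_boot perm ssralg zmodp fingroup.
From mathcomp Require Import boolp classical_sets functions cardinality.
Set Implicit Arguments.
Unset Strict Implicit.
Unset Printing Implicit Defensive.
Import GRing.Theory.
Local Open Scope classical_set_scope.

(** Writing K for a number larger than the number of Boolean profiles that n
elements can give to a colour, put N = 2K and q = N + 1. The base of the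
construction consists of q vertices, of all frames (bijections from q labels
to the vertices) and of a large supply of auxiliary points. Start from the set
algebra of all relations on these points that are invariant under permuting
the vertices and permuting the auxiliary points. Call an injective tuple a
padded edge if two of its entries are vertices and all the others are
auxiliary; the padded edges with given vertex positions form an atom of the
algebra. The algebra [split_algebra] arises by splitting each of these atoms
into N colours, abstractly: a cylindrification forgets the colour, and a
transposition keeps it. So each colour class has the same cylindrifications as
the whole atom, and the transposition of the two vertex positions fixes each
colour class.

This is impossible in a set algebra on a full power of a base. A frame names
the vertices by labels through functional relations, which already three
variables can express, so every representation has exactly q vertices
([split_algebra_no_embedding]). Fixing the auxiliary entries, the N colours
become pairwise disjoint symmetric irreflexive relations on q = N + 1 vertices,
each of them reaching every vertex. By counting, each is the graph of a fixed
point free involution on a set of odd size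
([no_odd_one_factorisation]).

All representations that do exist have one form ([pullback]): choose a map pi
from a base V to the points and a colouring f of the tuples over V, and send X
to the set of u such that (pi u, f u) lies in X. Equality is respected when pi
is injective, transpositions when f is symmetric, and cylindrifications when
moving one entry of a padded edge can produce every colour ([liftable]). Each
way of giving up one of these demands can be met.
- Without transpositions: colour the edge from x to y by the nonzero residue
  y - x modulo q. As x or y varies alone, every nonzero residue appears.
- Without cylindrifications: let the colour be the sum of the weights of the
  auxiliary entries.
- Without diagonals: replicate every point once for each colour, and add up
  the colours of the copies.
- For a subalgebra generated by n elements: colours with the same profile may
  be merged, so at most K have to be realised. Sums of vertex weights modulo K
  are symmetric, and q exceeds 2K, so every weight is carried by at least two
  vertices and is still available after the other vertex of the edge is
  excluded ([merged_representable]). *)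

(** * Embeddings and isomorphisms *)

Section Embeddings.
Variable S : signature.

Lemma hom_comp (A B C : algebra S) (f : A -> B) (g : B -> C) :
  homomorphism f -> homomorphism g -> homomorphism (g \o f).
Proof.
move=> hf hg o t; rewrite /= hf hg; congr (interp o _).
by apply/val_inj; rewrite /= map_comp.
Qed.

Lemma val_hom (A : algebra S) (X : set A) (clX : op_closed X) :
  @homomorphism S (subalgebra clX) A val.
Proof. by []. Qed.

Lemma range_closed (A B : algebra S) (f : A -> B) :
  homomorphism f -> op_closed (range f).
Proof.
move=> hf o t ht.
have /choice[g hg] : forall k, exists x, f x = tnth t k.
  by move=> k; have [x _ <-] := ht k; exists x.
exists (interp o (mktuple g)) => //; rewrite hf; congr (interp o _).
by apply/eq_from_tnth => k; rewrite tnth_map tnth_mktuple hg.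
Qed.

Lemma embedding_isomorphic (A B : algebra S) (f : A -> B)
    (hf : homomorphism f) :
  injective f -> isomorphic A (subalgebra (range_closed hf)).
Proof.
move=> injf.
have fP x : f x \in range f by rewrite inE; exists x.
pose g x : set_type (range f) := exist _ (f x) (fP x).
exists g; last first.
  move=> o t; apply: val_inj => /=; rewrite hf; congr (interp o _).
  by apply/val_inj; rewrite /= -map_comp.
have /choice[h hh] : forall y : set_type (range f), exists x, g x = y.
  move=> y; have [x _ xy] := set_mem (valP y).
  by exists x; apply: val_inj.
exists h => // x; apply: injf.
by have /(congr1 val) := hh (g x).
Qed.

End Embeddings.

Lemma isomorphic_Pse (alpha : nat) (V : Type)
    (A : polyadic_type_algebra alpha) (f : A -> full_set_algebra alpha V) :
  homomorphism f -> injective f ->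
  exists B : Pse alpha, isomorphic A (pse_algebra B).
Proof.
move=> hf injf; exists (MkPse (range_closed hf)).
exact: embedding_isomorphic.
Qed.

Lemma reduct_embeds_Pse (alpha : nat) (V : Type)
    (K : pred (op (polyadic_signature alpha))) (A : polyadic_type_algebra alpha)
    (f : reduct K A -> reduct K (full_set_algebra alpha V)) :
  homomorphism f -> injective f -> reduct_embeds_in_Pse K A.
Proof.
move=> hf injf.
have clT : op_closed [set: full_set_algebra alpha V] by [].
exists (MkPse clT).
have inT (X : full_set_algebra alpha V) : X \in [set: full_set_algebra alpha V].
  by rewrite inE.
pose g x : reduct K (pse_algebra (MkPse clT)) := exist _ (f x) (inT (f x)).
have hg : homomorphism g.
  move=> o t; apply: val_inj; rewrite [LHS]hf.
  change (@interp _ (full_set_algebra alpha V) (val o) (map_tuple f t) =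
          @interp _ (full_set_algebra alpha V) (val o)
            (map_tuple val (map_tuple g t))).
  congr (interp _ _).
  by apply/val_inj; rewrite /= -map_comp.
exists (range g), (range_closed hg); apply: embedding_isomorphic.
by move=> x y /(congr1 val)/injf.
Qed.

(** * Finite combinatorics *)

Section Combinatorics.

(** Moving along f matches the points that f raises with those it lowers, so
their total number is even; without fixed points that total is m. *)
Lemma odd_involution_fixpoint (m : nat) (f : 'I_m -> 'I_m) :
  odd m -> involutive f -> exists x, f x = x.
Proof.
move=> oddm fK; apply: contrapT => nofix.
have neqf x : f x != x by apply/eqP => fx; apply: nofix; exists x.
have imf : f @: [set x : 'I_m | x < f x]%SET = [set x : 'I_m | f x < x]%SET.
  apply/setP => y; rewrite inE; apply/imsetP/idP => [[x]|yf].
    by rewrite inE => xf ->; rewrite fK.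
  by exists (f y); rewrite ?fK // inE fK.
have := card_imset [set x : 'I_m | x < f x]%SET (inv_inj fK).
rewrite imf => eqc.
have : #|[set x : 'I_m | x < f x]%SET| + #|[set x : 'I_m | f x < x]%SET| = m.
  rewrite -[RHS](card_ord m) -(cardsC [set x : 'I_m | x < f x]%SET).
  congr (_ + _)%N.
  apply: eq_card => x; rewrite !inE -leqNgt [in RHS]leq_eqVlt.
  by have := neqf x; rewrite -(inj_eq val_inj) /= => /negPf ->.
by rewrite eqc addnn => mE; rewrite -mE odd_double in oddm.
Qed.

(** For every x, choosing one S c-neighbour for each c gives m.+1 distinct
points other than x, that is, all of them. So the S c-neighbour of x is unique
and every S c is the graph of an involution. *)
Lemma no_odd_one_factorisation (m : nat) (S : 'I_m.+1 -> rel 'I_m.+2) :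
  odd m.+2 -> (forall c, symmetric (S c)) -> (forall c, irreflexive (S c)) ->
  (forall c x, exists y, S c x y) ->
  (forall c c' x y, S c x y -> S c' x y -> c = c') -> False.
Proof.
move=> oddm symS irrS totS disjS.
pose f c x := xchoose (totS c x).
have fS c x : S c x (f c x) by exact: (xchooseP (totS c x)).
have injf x : injective (f^~ x).
  by move=> c c' eqf; apply: (disjS _ _ x (f c x)); rewrite ?fS // eqf fS.
have imf x : [set f c x | c : 'I_m.+1]%SET = [set~ x]%SET.
  apply/eqP; rewrite eqEcard card_imset // cardsC1 !card_ord leqnn andbT.
  apply/fintype.subsetP => _ /imsetP[c _ ->]; rewrite !inE.
  by apply/eqP => fx; have := fS c x; rewrite fx irrS.
have uniqS x y : S ord0 x y -> y = f ord0 x.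
  move=> Sxy; have : y \in [set~ x]%SET.
    by rewrite !inE; apply/eqP => yx; rewrite yx irrS in Sxy.
  rewrite -imf => /imsetP[c _ yE]; rewrite yE in Sxy *.
  by rewrite (disjS _ _ _ _ Sxy (fS c x)).
have fK : involutive (f ord0).
  by move=> x; apply/esym/uniqS; rewrite symS fS.
have [x fx] := odd_involution_fixpoint oddm fK.
by have := fS ord0 x; rewrite fx irrS.
Qed.

(** The permutation is built one point at a time: a transposition corrects the
image of the new point without moving the images already fixed. *)
Lemma perm_extend (T I : finType) (D : {set I}) (f g : I -> T) :
  {in D &, injective f} -> {in D &, injective g} ->
  exists s : {perm T}, {in D, forall i, s (f i) = g i}.
Proof.
move=> injf injg.
suff: forall r : seq I, uniq r -> {subset r <= D} ->
    exists s : {perm T}, {in r, forall i, s (f i) = g i}.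
  case/(_ (enum D) (enum_uniq _)) => [i|s sP]; first by rewrite mem_enum.
  by exists s => i Di; apply: sP; rewrite mem_enum.
elim=> [|i r IH] /=; first by exists 1%g.
case/andP => ir ur sub; have Di : i \in D by apply: sub; rewrite mem_head.
have subr : {subset r <= D} by move=> j jr; apply: sub; rewrite inE jr orbT.
have [s sP] := IH ur subr.
exists (s * tperm (s (f i)) (g i))%g => j; rewrite inE permM.
have [-> _|ji /= jr] := eqVneq j i; first by rewrite tpermL.
rewrite (sP _ jr) tpermD //; apply: contra_neq ji.
  by rewrite -(sP _ jr) => /perm_inj/injf -> //; apply: subr.
by move=> /injg -> //; apply: subr.
Qed.

End Combinatorics.
(** * The split algebra *)

Notation color k := 'I_(k.*2).+2.
Notation vertex k := 'I_(k.*2).+3.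

(** A frame is a bijection from labels to vertices; labels and vertices are
both numbered by [vertex k]. There are d auxiliary points for each weight in
[color k], so that in a d-tuple an entry can always be replaced by an
auxiliary point of any prescribed weight that is different from all the other
entries. *)
Inductive point (d k : nat) : Type :=
| Frame of {perm vertex k}
| Vertex of vertex k
| Aux of 'I_d * color k.

Definition update (d : nat) (V : Type) (u : 'I_d -> V) (i : 'I_d) (b : V) :
    'I_d -> V :=
  fun j => if j == i then b else u j.

Arguments update : simpl never.

Lemma update_same d V (u : 'I_d -> V) i b : update u i b i = b.
Proof. by rewrite /update eqxx. Qed.

Lemma update_other d V (u : 'I_d -> V) i b j :
  j != i -> update u i b j = u j.
Proof. by rewrite /update => /negPf ->. Qed.

Lemma transpE (d : nat) (W : Type) (i j : 'I_d) (X : set ('I_d -> W)) :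
  transp i j X = [set u : 'I_d -> W | X (u \o tperm i j)].
Proof.
apply/seteqP; split=> u /= => [[u' Xu' [ui uj uu']]|Xu].
  rewrite (_ : u \o _ = u') //; apply: funext => l /=.
  by case: tpermP => [->|->|/eqP li /eqP lj] //; apply: uu'.
exists (u \o tperm i j) => //=; rewrite tpermL tpermR; split=> // l li lj.
by rewrite tpermD // eq_sym.
Qed.

Section Algebra.
Variables (d k : nat).
Local Notation point := (point d k).
Local Notation color := (color k).
Local Notation vertex := (vertex k).
Implicit Types (u v : 'I_d -> point) (c e : color).
Implicit Types (X Y : set (('I_d -> point) * color)).

Definition is_frame (x : point) := if x is Frame _ then true else false.
Definition is_vertex (x : point) := if x is Vertex _ then true else false.

Definition vertices u : {set 'I_d} := [set i | is_vertex (u i)]%SET.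

(** Injectivity makes the two vertices distinct, and also the auxiliary
points; the latter is needed for transitivity of the symmetries on the padded
edges with given vertex positions. *)
Definition padded_edge u : Prop :=
  [/\ injective u, forall i, ~~ is_frame (u i) & #|vertices u| = 2].

(** Permuting the vertices acts on frames by composition, which preserves the
relation saying that a frame gives a vertex a certain label. *)
Definition act (s : {perm vertex}) (t : {perm 'I_d * color}) (x : point) :
    point :=
  match x with
  | Frame p => Frame d (p * s)%g
  | Vertex l => Vertex d (s l)
  | Aux m => Aux (t m)
  end.

Local Notation atom := (('I_d -> point) * color)%type.

Local Notation cylinder i X :=
  [set x : atom | exists2 y : atom, X y & forall j, j != i -> x.1 j = y.1 j].

(** Since p_ij keeps the colour, the colour classes of an atom that is fixed by
p_ij are fixed as well; since c_i forgets it, they all have the same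
cylindrifications. *)
Definition coloured_algebra : polyadic_type_algebra d :=
  @Algebra (polyadic_signature d) (set atom)
    (fun o => match o return
        (@arity (polyadic_signature d) o).-tuple (set atom) -> set atom with
     | Plus => fun t => tnth t ord0 `|` tnth t ord_max
     | Minus => fun t => ~` tnth t ord0
     | Cyl i => fun t => cylinder i (tnth t ord0)
     | Diag i j => fun=> [set x : atom | x.1 i = x.1 j]
     | Transp i j => fun t =>
         [set x : atom | tnth t ord0 (x.1 \o tperm i j, x.2)]
     end).

(** Only the colour of a padded edge is meaningful; on the other tuples an
admissible set cannot see it. Passing to these sets replaces a quotient of the
coloured tuples. *)
Definition admissible : set coloured_algebra := fun X =>
  (forall s t u c, X (u, c) -> X (act s t \o u, c)) /\
  (forall u c e, ~ padded_edge u -> X (u, c) -> X (u, e)).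

Lemma actK s t : cancel (act s t) (act s^-1 t^-1).
Proof. by case=> x /=; rewrite ?permK // mulgK. Qed.

Lemma vertices_tperm u i j :
  vertices (u \o tperm i j) = tperm i j @: vertices u.
Proof.
apply/setP => l; rewrite -[l in RHS](tpermK i j) mem_imset ?inE //.
exact: perm_inj.
Qed.

Lemma padded_edge_tperm u i j : padded_edge (u \o tperm i j) -> padded_edge u.
Proof.
case=> inju nfu; rewrite vertices_tperm card_imset; last exact: perm_inj.
move=> cu; split => // [x y|x].
  by rewrite -(tpermK i j x) -(tpermK i j y) => /inju ->.
by rewrite -(tpermK i j x); apply: nfu.
Qed.

Lemma padded_edge_act s t u : padded_edge u -> padded_edge (act s t \o u).
Proof.
have vE : vertices (act s t \o u) = vertices u.
  by apply/setP => i; rewrite !inE /=; case: (u i).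
case=> inju nfu cu; split => [|i|]; last by rewrite vE.
  by move=> i j /(can_inj (actK s t))/inju.
by have := nfu i; rewrite /=; case: (u i).
Qed.

Lemma admissible_setC X : admissible X -> admissible (~` X).
Proof.
case=> XG Xc; split=> [s t u c nX /(XG s^-1%g t^-1%g)|u c e eu nX Xe].
  rewrite (_ : _ \o _ = u) //; apply: funext => i /=; exact: actK.
by apply: nX; apply: Xc Xe.
Qed.

Lemma admissible_closed : op_closed admissible.
Proof.
case=> [||i|i j|i j] t ht /=.
- have [[X1 X2] [Y1 Y2]] := (ht ord0, ht ord_max).
  split=> [s r u c|u c e eu] [hX|hY].
  + by left; apply: X1. + by right; apply: Y1.
  + by left; apply: X2 hX. + by right; apply: Y2 hY.
- exact/admissible_setC/ht.
- have [X1 X2] := ht ord0.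
  split=> [s r u c [[v e] /= Xv uv]|u c e _ [v Xv uv]]; last by exists v.
  by exists (act s r \o v, e) => [|j ji /=]; [exact: X1|rewrite uv].
- by split=> // s r u c /= ->.
- have [X1 X2] := ht ord0; split=> [s r u c /=|u c e nu /=]; first exact: X1.
  by apply: X2 => /padded_edge_tperm.
Qed.

Definition split_algebra : polyadic_type_algebra d :=
  subalgebra admissible_closed.

(** The only colour-sensitive tuples are padded edges, and the symmetries act
transitively on those with given vertex positions. Consequently an admissible
set restricted to such padded edges is determined by a set of colours. *)
Lemma padded_edge_transitive u v :
  padded_edge u -> padded_edge v -> vertices u = vertices v ->
  exists s t, act s t \o u = v.
Proof.
case=> iu nu _ [iv nv _] uv.
pose vtx (x : point) := if x is Vertex l then l else ord0.
pose aux (x : point) (m0 : 'I_d * color) := if x is Aux m then m else m0.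
have vtxK (w : 'I_d -> point) i :
    i \in vertices w -> w i = Vertex d (vtx (w i)).
  by rewrite inE; case: (w i).
have auxK (w : 'I_d -> point) i : ~~ is_frame (w i) -> i \notin vertices w ->
    w i = Aux (aux (w i) (i, ord0)).
  by rewrite inE; case: (w i).
have [i j|i j|s sP] := @perm_extend _ _ (vertices u) (vtx \o u) (vtx \o v).
- by move=> ui uj /= ij; apply: iu; rewrite (vtxK u i) // (vtxK u j) // ij.
- rewrite uv => ui uj /= ij.
  by apply: iv; rewrite (vtxK v i) // (vtxK v j) // ij.
have [i j|i j|t tP] := @perm_extend _ _ (~: vertices u)
  (fun i => aux (u i) (i, ord0)) (fun i => aux (v i) (i, ord0)).
- rewrite !finset.in_setC => ui uj /= ij.
  by apply: iu; rewrite (auxK u i) // (auxK u j) // ij.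
- rewrite !finset.in_setC uv => ui uj /= ij.
  by apply: iv; rewrite (auxK v i) // (auxK v j) // ij.
exists s, t; apply: funext => i /=.
have [ui|ui] := boolP (i \in vertices u).
  by rewrite (vtxK u i) //= [RHS]vtxK -?uv //; congr Vertex; apply: sP.
rewrite (auxK u i) //= [RHS]auxK -?uv //; congr Aux; apply: tP.
by rewrite finset.in_setC.
Qed.

Definition merged (C : Type) (kappa : color -> C) : set coloured_algebra :=
  fun X => admissible X /\
    forall u c e, kappa c = kappa e -> X (u, c) -> X (u, e).

Lemma merged_setC (C : Type) (kappa : color -> C) X :
  merged kappa X -> merged kappa (~` X).
Proof.
case=> adX mX; split; first exact: admissible_setC.
by move=> u c e ce nX Xe; apply: nX; apply: mX Xe.
Qed.

Lemma merged_closed (C : Type) (kappa : color -> C) :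
  op_closed (merged kappa).
Proof.
move=> o t ht.
split; first by apply: admissible_closed => l; have [] := ht l.
case: o t ht => [||i|i j|i j] t ht u c e ce //=.
- have [[_ X] [_ Y]] := (ht ord0, ht ord_max).
  by case=> [/(X _ _ _ ce)|/(Y _ _ _ ce)]; [left|right].
- by apply: (merged_setC (ht ord0)).2.
- by have [_ X] := ht ord0; apply: X.
Qed.

Lemma merged_id X : admissible X -> merged id X.
Proof. by move=> adX; split=> // u c e ->. Qed.

(** * Representations by colourings *)

Definition pullback (V : Type) (pi : V -> point) (f : ('I_d -> V) -> color)
    (X : set atom) : set ('I_d -> V) :=
  [set u | X (pi \o u, f u)].

Section Pullback.
Variables (D : set coloured_algebra) (V : Type).
Variables (pi : V -> point) (f : ('I_d -> V) -> color).

(** The back condition for c_i at v: a tuple u over V that agrees with v off i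
can be changed at i into one whose coloured image no set in [D] separates from
(v, e), for any colour e. *)
Definition liftable (i : 'I_d) v : Prop :=
  forall (u : 'I_d -> V) e, (forall j, j != i -> pi (u j) = v j) ->
  exists2 u', forall j, j != i -> u j = u' j &
              forall X, D X -> X (v, e) -> X (pi \o u', f u').

Definition compatible (o : op (polyadic_signature d)) : Prop :=
  match o with
  | Plus | Minus => True
  | Cyl i => forall v, liftable i v
  | Diag _ _ => injective pi
  | Transp i j => forall u : 'I_d -> V, f (u \o tperm i j) = f u
  end.

Lemma pullback_interp (o : op (polyadic_signature d))
    (t : (arity o).-tuple coloured_algebra) :
  compatible o -> (forall l, D (tnth t l)) ->
  pullback pi f (interp o t) =
  @interp _ (full_set_algebra d V) o (map_tuple (pullback pi f) t).
Proof.
case: o t => [||i|i j|i j] t /= co Dt; rewrite ?tnth_map //.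
- apply/seteqP; split=> u /=.
    case=> -[v e] /= Xv uv; have [u' uu' hu'] := co v u e uv.
    by exists u' => //; apply: hu' Xv.
  by case=> u' Xu' uu'; exists (pi \o u', f u') => //= j ji; rewrite uu'.
- by apply/seteqP; split=> u; rewrite /pullback /diag /=; [exact: co|move=> ->].
- by rewrite transpE; apply/seteqP; split=> u /=; rewrite /pullback /= co.
Qed.

(** If (v, e) separated X from Y, lifting v would give a tuple over V that
separates their pullbacks. *)
Lemma pullback_inj :
  (forall X, D X -> D (~` X)) -> (forall y, exists x, pi x = y) ->
  (forall v, exists i, liftable i v) ->
  forall X Y, D X -> D Y -> pullback pi f X = pullback pi f Y -> X = Y.
Proof.
move=> DC /choice[pi' pi'K] lift.
suff sub X Y : D X -> D Y -> pullback pi f X = pullback pi f Y -> X `<=` Y.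
  by move=> X Y DX DY XY; apply/seteqP; split; apply: sub.
move=> DX DY XY [v e] Xv; apply: contrapT => nYv.
have [i liftv] := lift v.
have [j _|u _ hu] := liftv (pi' \o v) e; first exact: pi'K.
have : pullback pi f X u by apply: hu Xv.
by rewrite XY; apply: (hu (~` Y)) nYv; apply: DC.
Qed.

End Pullback.

Lemma reduct_representation (K : pred (op (polyadic_signature d)))
    (V : Type) (pi : V -> point) (f : ('I_d -> V) -> color) :
  (forall y, exists x, pi x = y) ->
  (forall v, exists i, liftable admissible pi f i v) ->
  (forall o, K o -> compatible admissible pi f o) ->
  reduct_embeds_in_Pse K split_algebra.
Proof.
move=> surjpi lift comp.
apply: (@reduct_embeds_Pse d V K split_algebra
  (fun x => pullback pi f (val x))).
  case=> o Ko t /=; rewrite (@pullback_interp admissible); first last.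
  - by move=> l; rewrite tnth_map; apply/set_mem/valP.
  - exact: comp.
  congr (@interp _ (full_set_algebra d V) o _).
  by apply/val_inj; rewrite /= -map_comp.
move=> x y xy; apply: val_inj; apply: (@pullback_inj admissible) xy => //.
- exact: admissible_setC.
- exact/set_mem/valP.
- exact/set_mem/valP.
Qed.

Lemma padded_edge_update v i b :
  padded_edge v -> ~~ is_frame b -> is_vertex b = is_vertex (v i) ->
  (forall j, j != i -> v j <> b) ->
  padded_edge (update v i b) /\ vertices (update v i b) = vertices v.
Proof.
case=> iv nv cv nb bv fresh.
have vE : vertices (update v i b) = vertices v.
  by apply/setP => j; rewrite !inE /update; case: eqP => // ->.
split=> //; split; rewrite ?vE //; last first.
  by move=> x; rewrite /update; case: ifP.
move=> x y; rewrite /update.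
case: (eqVneq x i) => [->|xi]; case: (eqVneq y i) => [->|yi] //.
- by move=> /esym/fresh; case.
- by move=> /fresh; case.
- exact: iv.
Qed.

Lemma merged_padded_edge (C : Type) (kappa : color -> C) X u v c e :
  merged kappa X -> padded_edge u -> padded_edge v ->
  vertices u = vertices v -> kappa c = kappa e -> X (u, c) -> X (v, e).
Proof.
case=> [[XG _] Xk] pu pv uv ce /(Xk _ _ _ ce).
have [s [t <-]] := padded_edge_transitive pu pv uv.
exact: XG.
Qed.

Lemma update_agree (V : Type) (u v : 'I_d -> V) i :
  (forall j, j != i -> u j = v j) -> update u i (v i) = v.
Proof.
by move=> uv; apply: funext => j; rewrite /update; case: eqVneq => [->|/uv].
Qed.

Lemma liftable_not_padded (D : set coloured_algebra) f i v :
  (forall X, D X -> admissible X) -> ~ padded_edge v ->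
  liftable D (@id point) f i v.
Proof.
move=> Dad npv u e uv; exists (update u i (v i)) => [j ji|X DX].
  by rewrite update_other.
rewrite update_agree //; exact: (Dad _ DX).2.
Qed.

(** One of the d auxiliary points of weight c is missed by the at most d - 1
entries of v at positions other than i. *)
Lemma fresh_aux v i c : exists r, forall j, j != i -> v j <> Aux (r, c).
Proof.
apply: contrapT => nofresh.
have /choice[g gP] : forall r, exists j, j != i /\ v j = Aux (r, c).
  move=> r; apply: contrapT => nj; apply: nofresh; exists r => j ji vj.
  by apply: nj; exists j.
have injg : injective g.
  by move=> r r' gr; have := (gP r).2; rewrite gr (gP r').2 => -[].
have : #|[set g r | r : 'I_d]%SET| <= #|[set~ i]%SET|.
  apply: subset_leq_card; apply/fintype.subsetP => _ /imsetP[r _ ->].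
  by rewrite !inE (gP r).1.
rewrite card_imset // cardsC1 !card_ord leqNgt prednK ?leqnn //.
exact: leq_ltn_trans (ltn_ord i).
Qed.

(** * Weight colourings *)

Section Weight.
Local Open Scope ring_scope.
Variables (Z : zmodType) (w : point -> Z) (gamma : point -> point -> Z).

(** The pairs are ordered by position. The [gamma] term will vanish unless both
points are vertices, so on a padded edge it has a single nonzero summand, the
value at its two vertices. *)
Definition weight u : Z :=
  \sum_i w (u i) +
  \sum_(p : 'I_d * 'I_d | (p.1 < p.2)%N) gamma (u p.1) (u p.2).

Hypothesis gamma0 :
  forall x y, ~~ (is_vertex x && is_vertex y) -> gamma x y = 0.
Hypothesis aux_onto : forall z, exists c, forall r, w (Aux (r, c)) = z.

Lemma weight_update v i b :
  ~~ is_vertex b -> ~~ is_vertex (v i) ->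
  weight (update v i b) = weight v - w (v i) + w b.
Proof.
move=> nb nv; rewrite /weight (bigD1 i) //=.
rewrite (bigD1 (F := fun j => w (v j)) i) //=.
rewrite update_same (eq_bigr (fun j => w (v j))); last first.
  by move=> j ji; rewrite update_other.
rewrite (eq_bigr (fun p => gamma (v p.1) (v p.2))); last first.
  move=> [j l] _ /=; rewrite /update.
  case: (eqVneq j i) => [->|_].
    by rewrite !gamma0 ?(negPf nb) ?(negPf nv).
  case: (eqVneq l i) => [->|_] //.
  by rewrite !gamma0 ?(negPf nb) ?(negPf nv) ?andbF.
rewrite -addrA [RHS]addrC; congr (_ + _).
by rewrite -[w (v i) + _ + _]addrA [w (v i) + _]addrC addrK.
Qed.

Variables (C : Type) (kappa : color -> C) (rho : Z -> color).
Hypothesis rho_onto : forall e, exists z, kappa (rho z) = kappa e.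

(** Some colour in the class of e is coded by a weight z; it suffices to reach
the weight z by moving the i-th entry within its sort. *)
Lemma liftable_padded v i :
  padded_edge v ->
  (forall z, exists b, [/\ ~~ is_frame b, is_vertex b = is_vertex (v i),
     forall j, j != i -> v j <> b & weight (update v i b) = z]) ->
  liftable (merged kappa) id (rho \o weight) i v.
Proof.
move=> pv solve u e uv; have [z ze] := rho_onto e.
have [b [nfb bv fresh wb]] := solve z.
have [pv' vv'] := padded_edge_update pv nfb bv fresh.
exists (update v i b) => [j ji|X DX]; first by rewrite update_other // uv.
by apply: (merged_padded_edge DX pv pv'); rewrite //= ?wb.
Qed.

Lemma liftable_aux v i :
  padded_edge v -> ~~ is_vertex (v i) ->
  liftable (merged kappa) id (rho \o weight) i v.
Proof.
move=> pv nvi; apply: liftable_padded => // z.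
have [c cP] := aux_onto (z - (weight v - w (v i))).
have [r rP] := fresh_aux v i c.
exists (Aux (r, c)); split=> //; first by rewrite (negPf nvi).
by rewrite weight_update // cP addrC subrK.
Qed.

Hypothesis vertex_solve : forall y z,
  (exists2 x, x != y & w (Vertex d x) + gamma (Vertex d x) (Vertex d y) = z) /\
  (exists2 x, x != y & w (Vertex d x) + gamma (Vertex d y) (Vertex d x) = z).

Lemma liftable_vertex v i :
  padded_edge v -> is_vertex (v i) ->
  liftable (merged kappa) id (rho \o weight) i v.
Proof.
move=> pv vi; apply: liftable_padded => // z.
have [iv nv /eqP/cards2P[i1 [i2 [i12 vE]]]] := pv.
have {i1 i2 i12 vE} [i' ii' vE] :
    exists2 i', i' != i & vertices v = [set i; i']%SET.
  have : i \in vertices v by rewrite inE.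
  rewrite vE !inE => /orP[]/eqP->; first by exists i2 => //; rewrite eq_sym.
  by exists i1 => //; rewrite finset.setUC.
have [y vi'] : exists y, v i' = Vertex d y.
  have : i' \in vertices v by rewrite vE !inE eqxx orbT.
  by rewrite inE; case: (v i') => // y; exists y.
have nvtx j : j != i -> j != i' -> ~~ is_vertex (v j).
  move=> ji ji'; have : j \notin vertices v by rewrite vE !inE negb_or ji.
  by rewrite inE.
(* As the vertex at i varies, only its own weight and the gamma value of the
   edge vary; k0 is the rest. *)
pose k0 := \sum_(j | j != i) w (v j).
have wE x : weight (update v i (Vertex d x)) = w (Vertex d x) +
    (if (i < i')%N then gamma (Vertex d x) (Vertex d y)
     else gamma (Vertex d y) (Vertex d x)) + k0.
  rewrite /weight (bigD1 i) //= update_same.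
  rewrite (eq_bigr (fun j => w (v j))); last first.
    by move=> j ji; rewrite update_other.
  rewrite -addrA -/k0 [k0 + _]addrC addrA; congr (_ + _ + _).
  pose p0 := if (i < i')%N then (i, i') else (i', i).
  have p0P : (p0.1 < p0.2)%N.
    by rewrite /p0; case: ifP => //= nlt; rewrite ltn_neqAle leqNgt nlt andbT.
  rewrite (bigD1 p0) //= big1 ?addr0.
    by rewrite /p0; case: ifP => _ /=; rewrite update_same update_other // vi'.
  case=> j l /andP[/= jl jlp]; apply: gamma0; apply: contraNN jlp.
  have vin h : is_vertex (update v i (Vertex d x) h) -> (h == i) || (h == i').
    rewrite /update; case: eqP => //= /eqP hi; apply: contraTT => hi'.
    exact: nvtx.
  case/andP=> /vin/orP[]/eqP jE /vin/orP[]/eqP lE; move: jl; rewrite jE lE /p0.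
  - by rewrite ltnn.
  - by move=> ->; rewrite eqxx.
  - by move=> /ltnW; rewrite leqNgt => /negPf ->; rewrite eqxx.
  - by rewrite ltnn.
have [x xy xz] : exists2 x, x != y & w (Vertex d x) +
    (if (i < i')%N then gamma (Vertex d x) (Vertex d y)
     else gamma (Vertex d y) (Vertex d x)) = z - k0.
  by have [] := vertex_solve y (z - k0); case: (i < i')%N.
exists (Vertex d x); split=> //; last by rewrite wE xz subrK.
move=> j ji vj; have [ji'|ji'] := eqVneq j i'.
  by move: vj xy; rewrite ji' vi' => -[->]; rewrite eqxx.
by have := nvtx j ji ji'; rewrite vj.
Qed.

Lemma liftable_weight v i : liftable (merged kappa) id (rho \o weight) i v.
Proof.
have [pv|npv] := pselect (padded_edge v); last first.
  by apply: liftable_not_padded => // X [].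
have [vi|vi] := boolP (is_vertex (v i)); first exact: liftable_vertex.
exact: liftable_aux.
Qed.

End Weight.

(** * Representing the three reducts *)

Section Representations.
Local Open Scope ring_scope.

Definition aux_colour (x : point) : color := if x is Aux m then m.2 else 0.

(** The residue m - l of distinct vertices is nonzero modulo q = N + 1;
[unlift ord0] shifts the nonzero residues to the N colours. *)
Definition difference (x y : point) : color :=
  match x, y with
  | Vertex l, Vertex m => odflt 0 (unlift ord0 (m - l))
  | _, _ => 0
  end.

Lemma aux_colour_onto (z : color) :
  exists c, forall r, aux_colour (Aux (r, c)) = z.
Proof. by exists z. Qed.

Lemma weight_tperm (Z : zmodType) (w : point -> Z) u i j :
  weight w (fun _ _ => 0) (u \o tperm i j) = weight w (fun _ _ => 0) u.
Proof.
rewrite /weight !big1_eq !addr0 [RHS](reindex_inj (@perm_inj _ (tperm i j))).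
by [].
Qed.

Lemma admissible_liftable V (pi : V -> point) f i v :
  liftable (merged (@id color)) pi f i v -> liftable admissible pi f i v.
Proof.
move=> lift u e uv; have [u' uu' hu'] := lift u e uv.
by exists u' => // X /merged_id; apply: hu'.
Qed.

(** The colouring need not be symmetric, so the difference of the two vertices
may serve; it takes each colour once as either end varies. *)
Lemma transp_free_representable :
  (0 < d)%N -> reduct_embeds_in_Pse (@transp_free d) split_algebra.
Proof.
move=> d0.
have lift i v : liftable admissible id (id \o weight aux_colour difference) i v.
  apply/admissible_liftable/liftable_weight => //.
  - by case=> ? [] ?.
  - exact: aux_colour_onto.
  - by move=> e; exists e.
  have lift0 (z : color) : lift ord0 z != 0 :> vertex.
    by rewrite eq_sym; exact: neq_lift.
  move=> y z; split.
    exists (y - lift ord0 z); last by rewrite /= subKr liftK add0r.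
    by rewrite -subr_eq0 addrAC subrr add0r oppr_eq0.
  exists (y + lift ord0 z); last by rewrite /= [y + _]addrC addrK liftK add0r.
  by rewrite -subr_eq0 addrAC subrr add0r.
apply: (reduct_representation _ _ _ (pi := id)
  (f := id \o weight aux_colour difference)) => [y|v|o].
- by exists y.
- by exists (Ordinal d0).
- by case: o => [||i|i j|i j] //= _ v //; apply: lift.
Qed.

(** Lifting is only needed to see that every colour occurs, and for this it is
enough to move an auxiliary entry, which exists since d > 2. *)
Lemma cyl_free_representable :
  (3 <= d)%N -> reduct_embeds_in_Pse (@cyl_free d) split_algebra.
Proof.
move=> d3.
apply: (reduct_representation _ _ _ (pi := id)
  (f := id \o weight aux_colour (fun _ _ => 0))) => [y|v|o].
- by exists y.
- have [pv|npv] := pselect (padded_edge v); last first.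
    by exists (Ordinal (ltnW (ltnW d3))); apply: liftable_not_padded.
  have [i vi] : exists i, ~~ is_vertex (v i).
    apply: contrapT => nvi; have [_ _] := pv.
    rewrite (_ : vertices v = [set i | true]%SET) ?cardsT ?card_ord.
      by move=> d2; rewrite d2 in d3.
    apply/setP => i; rewrite !inE; apply/negPn/negP => vi.
    by apply: nvi; exists i.
  exists i; apply/admissible_liftable/liftable_aux => //.
  + exact: aux_colour_onto.
  + by move=> e; exists e.
- by case: o => [||i|i j|i j] //= _ u //; apply: weight_tperm.
Qed.

(** A padded edge is lifted by replacing a point with another copy of the same
point, so no new vertices are needed to realise all colours. *)
Lemma diag_free_representable :
  (0 < d)%N -> reduct_embeds_in_Pse (@diag_free d) split_algebra.
Proof.
move=> d0.
pose f (u : 'I_d -> point * color) : color := \sum_i (u i).2.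
have lift i v : liftable admissible fst f i v.
  move=> u e uv; pose b := e - \sum_(j | j != i) (u j).2.
  exists (update u i (v i, b)) => [j ji|X _]; first by rewrite update_other.
  rewrite (_ : fst \o _ = v); last first.
    by apply: funext => j; rewrite /= /update; case: eqVneq => [->|/uv].
  rewrite /f (bigD1 i) //= update_same (eq_bigr (fun j => (u j).2)); last first.
    by move=> j ji; rewrite update_other.
  by rewrite subrK.
apply: (reduct_representation _ _ _ (pi := fst) (f := f)) => [y|v|o].
- by exists (y, 0).
- by exists (Ordinal d0).
case: o => [||i|i j|i j] //= _ u.
by rewrite /f [RHS](reindex_inj (@perm_inj _ (tperm i j))).
Qed.

End Representations.

(** * Representing subalgebras with few generators *)

Section Merging.
Local Open Scope ring_scope.

(** With K = k + 1 there are 2 K + 1 vertices, so each residue z modulo K is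
attained at least at the vertices z and z + K. *)
Definition residue (x : point) : 'I_k.+1 :=
  match x with
  | Frame _ => 0
  | Vertex l => inZp l
  | Aux m => inZp m.2
  end.

(** Sums of residues are symmetric, and they give every class of colours a
code in 'I_k.+1. Once one vertex is excluded, each residue is still carried by
another one. *)
Lemma merged_representable (T : finType) (prof : color -> T)
    (X : set split_algebra) (clX : op_closed X) :
  (0 < d)%N -> (#|T| <= k.+1)%N -> (forall x, X x -> merged prof (val x)) ->
  exists B : Pse d, isomorphic (subalgebra clX) (pse_algebra B).
Proof.
move=> d0 cardT Xprof.
pose rho (z : 'I_k.+1) : color :=
  odflt 0 [pick c | enum_rank (prof c) == z :> nat].
have rho_onto e : exists z, prof (rho z) = prof e.
  exists (inord (enum_rank (prof e))); rewrite /rho inordK; last first.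
    exact: leq_trans (ltn_ord _) cardT.
  case: pickP => [c /eqP/ord_inj/enum_rank_inj //|/(_ e)].
  by rewrite eqxx.
have lift i v : liftable (merged prof) id
    (rho \o weight residue (fun _ _ => 0)) i v.
  apply: liftable_weight => //.
    move=> z; exists (inord z) => r; apply: ord_inj => /=.
    rewrite inordK ?modn_small //; apply: leq_trans (ltn_ord z) _.
    by rewrite ltnS -addnn (leq_trans (leq_addr k k)) // leqW.
  have kz (z : 'I_k.+1) : (z + k.+1 < (k.*2).+3)%N.
    by rewrite addnS -addnn !ltnS -addSn leq_add2r ltnW // ltn_ord.
  have zk (z : 'I_k.+1) : (z < (k.*2).+3)%N.
    by apply: leq_ltn_trans (kz z); rewrite leq_addr.
  suff solve (y : vertex) (z : 'I_k.+1) :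
      exists2 x, x != y & residue (Vertex d x) = z.
    by move=> y z; have [x xy xz] := solve y z; split; exists x; rewrite ?addr0.
  have [zy|zy] := eqVneq (Ordinal (zk z)) y; last first.
    by exists (Ordinal (zk z)) => //; apply: ord_inj; rewrite /= modn_small.
  exists (Ordinal (kz z)); last by apply: ord_inj; rewrite /= modnDr modn_small.
  by rewrite -zy -val_eqE /= -[X in _ != X]addn0 eqn_add2l.
pose F (x : subalgebra clX) : full_set_algebra d point :=
  pullback id (rho \o weight residue (fun _ _ => 0)) (val (val x)).
have merged_val (x : subalgebra clX) : merged prof (val (val x)).
  exact/Xprof/set_mem/valP.
apply: (@isomorphic_Pse d point (subalgebra clX) F).
  move=> o t; rewrite /F /= (@pullback_interp (merged prof)); first last.
  - by move=> l; rewrite !tnth_map; apply: merged_val.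
  - by case: o {t} => [||i|i j|i j] //= u; rewrite weight_tperm.
  congr (@interp _ (full_set_algebra d point) o _).
  by apply/val_inj; rewrite /= -!map_comp.
move=> x y xy; apply/val_inj/val_inj.
apply: (@pullback_inj (merged prof)) xy => //.
- exact: merged_setC.
- by move=> y'; exists y'.
- by exists (Ordinal d0).
Qed.

(** The profile of a colour records, for each generator and each choice of
vertex positions, whether the generator contains the padded edges of that
colour. Colours with the same profile are not separated by the generators,
hence not by anything they generate. *)
Lemma n_generated_representable (n : nat) (X : set split_algebra)
    (clX : op_closed X) :
  (0 < d)%N -> (#|{ffun 'I_n * {set 'I_d} -> bool}| <= k.+1)%N ->
  n_generated n (subalgebra clX) ->
  exists B : Pse d, isomorphic (subalgebra clX) (pse_algebra B).
Proof.
move=> d0 cardk [G /pcard_leP[h] genG].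
pose prof (c : color) : {ffun 'I_n * {set 'I_d} -> bool} :=
  [ffun p : 'I_n * {set 'I_d} => `[< exists x, [/\ G x, h x = p.1 :> nat &
     exists u, [/\ padded_edge u, vertices u = p.2 & val (val x) (u, c)]] >]].
have ad_val (x : subalgebra clX) : admissible (val (val x)).
  exact/set_mem/valP.
pose Y := [set x : subalgebra clX | merged prof (val (val x))].
have GY : G `<=` Y.
  move=> g Gg; split=> // u c e ce.
  have [pu|npu] := pselect (padded_edge u); last first.
    by have [_ irrel] := ad_val g; apply: irrel.
  move=> gc; have hg : (h g < n)%N by exact: (@funS _ _ _ _ h g Gg).
  have : prof c (Ordinal hg, vertices u).
    by rewrite ffunE; apply/asboolP; exists g; split=> //; exists u.
  rewrite ce ffunE => /asboolP[g' [Gg' /= hg' [u' [pu' uu' ge]]]].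
  have gg' : g' = g by apply: (@inj _ _ _ h); rewrite ?inE.
  rewrite gg' in ge.
  exact: merged_padded_edge (merged_id (ad_val g)) pu' pu uu' _ ge.
have clY : op_closed Y.
  move=> o t ht; apply: (merged_closed (kappa := prof)) => l.
  by rewrite !tnth_map; apply: ht.
apply: (merged_representable (prof := prof)) => // x Xx.
apply: contrapT => nx; apply: genG; exists Y; split=> //.
rewrite properEneq; split=> //; apply/eqP => YT.
have : Y (exist _ x (mem_set Xx)) by rewrite YT.
exact: nx.
Qed.

End Merging.

(** * Non-representability *)

Section NonRepresentability.
Hypothesis d3 : 3 <= d.
Variables (V : Type) (psi : split_algebra -> full_set_algebra d V).
Hypotheses (psi_hom : homomorphism psi) (psi_inj : injective psi).

(** The embedding psi, extended to arbitrary sets of coloured tuples by giving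
the others an empty value; this avoids carrying proofs of admissibility inside
terms. *)
Definition denote X : set ('I_d -> V) :=
  [set u | exists adX : X \in admissible, psi (exist _ X adX) u].

Lemma denoteE X (adX : X \in admissible) : denote X = psi (exist _ X adX).
Proof.
apply/seteqP; split=> [u [adX']|u Xu]; last by exists adX.
by rewrite (bool_irrelevance adX' adX).
Qed.

Lemma denote_interp (o : op (polyadic_signature d))
    (t : (arity o).-tuple coloured_algebra) :
  (forall l, admissible (tnth t l)) ->
  denote (interp o t) =
  @interp _ (full_set_algebra d V) o (map_tuple denote t).
Proof.
move=> adt.
pose t' : (arity o).-tuple split_algebra :=
  mktuple (fun l => exist _ (tnth t l) (mem_set (adt l))).
have tE : t = map_tuple val t'.
  by apply: eq_from_tnth => l; rewrite tnth_map tnth_mktuple.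
rewrite [in LHS]tE (denoteE (closed_interp admissible_closed t')).
rewrite -[exist _ _ _]/(@interp _ split_algebra o t') psi_hom.
congr (@interp _ (full_set_algebra d V) o _).
apply: eq_from_tnth => l; rewrite [LHS]tnth_map [RHS]tnth_map tnth_mktuple.
by rewrite (denoteE (mem_set (adt l))).
Qed.

Lemma admissible_setU X Y :
  admissible X -> admissible Y -> admissible (X `|` Y).
Proof.
move=> adX adY; apply: (@admissible_closed (Plus d) [tuple X; Y]) => l.
by rewrite (tnth_nth X); case: l => [[|[|l]]].
Qed.

Lemma denote_setU X Y : admissible X -> admissible Y ->
  denote (X `|` Y) = denote X `|` denote Y.
Proof.
move=> adX adY; apply: (@denote_interp (Plus d) [tuple X; Y]) => l.
by rewrite (tnth_nth X); case: l => [[|[|l]]].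
Qed.

Lemma denote_setC X : admissible X -> denote (~` X) = ~` denote X.
Proof.
move=> adX; apply: (@denote_interp (Minus d) [tuple X]) => l.
by rewrite (tnth_nth X); case: l => [[|l]].
Qed.

Lemma denote_cyl i X : admissible X ->
  denote (cylinder i X) =
  cyl i (denote X).
Proof.
move=> adX; apply: (@denote_interp (Cyl i) [tuple X]) => l.
by rewrite (tnth_nth X); case: l => [[|l]].
Qed.

Lemma denote_diag i j : denote [set x : atom | x.1 i = x.1 j] = @diag d V i j.
Proof. by apply: (@denote_interp (Diag i j) [tuple]) => -[]. Qed.

Lemma denote_transp i j X (u : 'I_d -> V) : admissible X ->
  denote [set x : atom | X (x.1 \o tperm i j, x.2)] u =
  denote X (u \o tperm i j).
Proof.
move=> adX.
rewrite -[RHS]/([set u : 'I_d -> V | denote X (u \o tperm i j)] u) -transpE.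
congr (_ u); apply: (@denote_interp (Transp i j) [tuple X]) => l.
by rewrite (tnth_nth X); case: l => [[|l]].
Qed.

Lemma admissible_diag i j : admissible [set x : atom | x.1 i = x.1 j].
Proof. by apply: (@admissible_closed (Diag i j) [tuple]) => -[]. Qed.

Lemma admissible_cyl i X : admissible X ->
  admissible (cylinder i X).
Proof.
move=> adX; apply: (@admissible_closed (Cyl i) [tuple X]) => l.
by rewrite (tnth_nth X); case: l => [[|l]].
Qed.

Lemma admissible_transp i j X : admissible X ->
  admissible [set x : atom | X (x.1 \o tperm i j, x.2)].
Proof.
move=> adX; apply: (@admissible_closed (Transp i j) [tuple X]) => l.
by rewrite (tnth_nth X); case: l => [[|l]].
Qed.

Lemma admissible_setI X Y :
  admissible X -> admissible Y -> admissible (X `&` Y).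
Proof.
move=> adX adY; rewrite -[X `&` Y]setCK setCI.
by apply/admissible_setC/admissible_setU; apply: admissible_setC.
Qed.

Lemma denote_setI X Y : admissible X -> admissible Y ->
  denote (X `&` Y) = denote X `&` denote Y.
Proof.
move=> adX adY; rewrite -[X `&` Y]setCK setCI.
have [nX nY] := (admissible_setC adX, admissible_setC adY).
rewrite denote_setC ?denote_setU ?denote_setC //; last exact: admissible_setU.
by rewrite setCU !setCK.
Qed.

Lemma denote_sub X Y : admissible X -> admissible Y -> X `<=` Y ->
  denote X `<=` denote Y.
Proof.
by move=> adX adY /setUidPr <- u Xu; rewrite denote_setU //; left.
Qed.

Lemma admissible_set0 : admissible set0.
Proof. by split. Qed.

Lemma denote_set0 : denote set0 = set0.
Proof.
have ad0 := admissible_set0; have adT := admissible_setC ad0.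
rewrite -(setICr set0) denote_setI // denote_setC //; exact: setICr.
Qed.

Lemma denote_nonempty X : admissible X -> X !=set0 -> denote X !=set0.
Proof.
move=> adX /set0P X0; apply/set0P; apply: contra_neq X0 => iX.
have : psi (exist _ X (mem_set adX)) =
       psi (exist _ set0 (mem_set admissible_set0)).
  by rewrite -!denoteE iX denote_set0.
by move=> /psi_inj[].
Qed.

(** A finite disjunction is a statement of the language of the algebra, so it
transfers to the representation. *)
Lemma denote_cover (I : finType) (F : I -> set atom) X (u : 'I_d -> V) :
  admissible X -> (forall i, admissible (F i)) ->
  X `<=` [set x | exists i, F i x] -> denote X u -> exists i, denote (F i) u.
Proof.
move=> adX adF XF Xu; apply: contrapT => nF.
suff [adE nE] : admissible [set x | exists2 i, i \in enum I & F i x] /\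
    ~ denote [set x | exists2 i, i \in enum I & F i x] u.
  apply: nE; apply: denote_sub Xu => // x /XF[i Fx].
  by exists i; rewrite ?mem_enum.
elim: (enum I) => [|i s [adE nE]].
  rewrite (_ : [set x | _] = set0) ?denote_set0; last first.
    by apply/seteqP; split=> x // [].
  by split=> //; apply: admissible_set0.
rewrite (_ : [set x | _] = F i `|` [set x | exists2 j, j \in s & F j x]).
  split; first exact: admissible_setU.
  by rewrite denote_setU // => -[Fu|//]; apply: nF; exists i.
apply/seteqP; split=> x.
  case=> j; rewrite inE => /orP[/eqP ->|js] Fx; first by left.
  by right; exists j.
case=> [Fx|[j js Fx]]; first by exists i; rewrite ?mem_head.
by exists j; rewrite // inE js orbT.
Qed.

(** A relation that does not depend on its i-th argument is fixed by c_i. *)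
Lemma denote_update i X (u : 'I_d -> V) b : admissible X ->
  (forall x y : atom, X y -> (forall j, j != i -> x.1 j = y.1 j) -> X x) ->
  denote X u -> denote X (update u i b).
Proof.
move=> adX indep Xu.
have : cyl i (denote X) (update u i b).
  by exists u => // j ji; rewrite update_other.
rewrite -denote_cyl //; apply: denote_sub => //; first exact: admissible_cyl.
by move=> x [y Xy xy]; apply: indep xy.
Qed.

Let i0 : 'I_d := Ordinal (ltnW (ltnW d3)).
Let i1 : 'I_d := Ordinal (ltnW d3).
Let i2 : 'I_d := Ordinal d3.

Definition vertex_at i : set atom := [set x | is_vertex (x.1 i)].
Definition frame_at i : set atom := [set x | is_frame (x.1 i)].
Definition named i j (l : vertex) : set atom :=
  [set x | exists2 p, x.1 i = Frame d p & x.1 j = Vertex d (p l)].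
Definition edge c : set atom :=
  [set x | [/\ padded_edge x.1, is_vertex (x.1 i0), is_vertex (x.1 i1) &
               x.2 = c]].

Lemma admissible_vertex_at i : admissible (vertex_at i).
Proof. by split=> // s t u c; rewrite /vertex_at /=; case: (u i). Qed.

Lemma admissible_frame_at i : admissible (frame_at i).
Proof. by split=> // s t u c; rewrite /frame_at /=; case: (u i). Qed.

Lemma admissible_named i j l : admissible (named i j l).
Proof.
split=> // s t u c [p /= ui uj]; exists (p * s)%g; rewrite /= ?ui ?uj //.
by rewrite permM.
Qed.

Lemma admissible_edge c : admissible (edge c).
Proof.
split=> [s t u e [/= pu u0 u1 ec]|u e e' npu [//]].
split=> //=; first exact: padded_edge_act.
  by case: (u i0) u0.
by case: (u i1) u1.
Qed.

Lemma edge_nonempty c : edge c !=set0.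
Proof.
pose u i : point := if i == i0 then Vertex d ord0 else
  if i == i1 then Vertex d ord_max else Aux (i, ord0).
exists (u, c); split=> //=; split=> [x y|x|].
- rewrite /u; have [xE|_] := eqVneq x i0; have [yE|_] := eqVneq y i0;
    have [xE'|_] := eqVneq x i1; have [yE'|_] := eqVneq y i1;
    by [congruence|case].
- by rewrite /u; case: eqP => // _; case: eqP.
- rewrite (_ : vertices u = [set i0; i1]%SET) ?cards2 //.
  by apply/setP => i; rewrite !inE /u; case: eqP => // _; case: eqP.
Qed.

(** This lets the algebra express, by diagonals and cylindrifications, that any
two distinct vertices can take the place of those of a padded edge. *)
Lemma padded_edge_move u v i j :
  padded_edge u -> is_vertex (u i) -> is_vertex (u j) -> v i <> v j ->
  is_vertex (v i) -> is_vertex (v j) ->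
  (forall h, h != i -> h != j -> v h = u h) -> padded_edge v.
Proof.
move=> [iu nu cu] ui uj vij vi vj vu.
have ij : i != j by apply/eqP => ij; apply: vij; rewrite ij.
have uE : vertices u = [set i; j]%SET.
  apply/esym/eqP; rewrite eqEcard cu cards2 ij andbT.
  by apply/fintype.subsetP => h; rewrite !inE => /orP[]/eqP ->.
have vE : vertices v = vertices u.
  apply/setP => h; rewrite !inE.
  have [->|hi] := eqVneq h i; first by rewrite vi.
  by have [->|hj] := eqVneq h j; [rewrite vj|rewrite vu].
have out h : h != i -> h != j -> ~~ is_vertex (v h).
  by move=> hi hj; have : h \notin vertices v;
    [rewrite vE uE !inE negb_or hi|rewrite inE].
split=> [x y vxy|h|]; last by rewrite vE.
  have [xi|xi] := eqVneq x i; have [yi|yi] := eqVneq y i; rewrite ?xi ?yi //.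
  - have [yj|yj] := eqVneq y j; first by case: vij; rewrite -xi -yj.
    by have := out _ yi yj; rewrite -vxy xi vi.
  - have [xj|xj] := eqVneq x j; first by case: vij; rewrite -yi -xj.
    by have := out _ xi xj; rewrite vxy yi vi.
  have [xj|xj] := eqVneq x j; have [yj|yj] := eqVneq y j; rewrite ?xj ?yj //.
  - by have := out _ yi yj; rewrite -vxy xj vj.
  - by have := out _ xi xj; rewrite vxy yj vj.
  by apply: iu; rewrite -!vu.
have [->|hi] := eqVneq h i; first by case: (v i) vi.
by have [->|hj] := eqVneq h j; [case: (v j) vj|rewrite vu].
Qed.

Lemma split_algebra_no_embedding : False.
Proof.
have adE := admissible_edge; have adN := admissible_named.
have adF := admissible_frame_at; have adV := admissible_vertex_at.
have i01 : i1 != i0 by [].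
have i02 : i2 != i0 by [].
have i12 : i2 != i1 by [].
(* A represented padded edge v supplies the auxiliary entries; exchanging its
   entry at i2 for a represented frame gives v'. *)
have [v vE] := denote_nonempty (adE ord0) (edge_nonempty ord0).
have [v' v'F vv'] : cyl i2 (denote (frame_at i2)) v.
  rewrite -denote_cyl //; apply: denote_sub vE => //.
    exact: admissible_cyl.
  move=> x _; exists (update x.1 i2 (Frame d 1%g), ord0) => [|j j2 /=].
    by rewrite /frame_at /= ?update_same.
  by rewrite update_other.
(* Edges are read off r x y, and labels off t x y; they differ at i2 only. *)
pose r x y := update (update v i0 x) i1 y.
pose t x y := update (update v' i0 x) i1 y.
have rt x y j : j != i2 -> r x y j = t x y j.
  move=> j2; rewrite /r /t /update; case: ifP => // _; case: ifP => // _.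
  exact: vv'.
have swapE w x y : update (update w i0 x) i1 y \o tperm i0 i1 =
                   update (update w i0 y) i1 x :> ('I_d -> V).
  apply: funext => j /=; case: tpermP => [->|->|/eqP j0 /eqP j1].
  - by rewrite update_same update_other // update_same.
  - by rewrite update_other // !update_same.
  - by rewrite !update_other.
have tF x y : denote (frame_at i2) (t x y).
  have indep (i : 'I_d) : i2 != i -> forall z w : atom, frame_at i2 w ->
      (forall j, j != i -> z.1 j = w.1 j) -> frame_at i2 z.
    by move=> i2i z w wF zw; rewrite /frame_at /= zw.
  by do 2![apply: denote_update => //; first exact: indep].
have named1 l x y y' :
    denote (named i2 i0 l) (t x y) -> denote (named i2 i0 l) (t x y').
  have -> : t x y' = update (t x y) i1 y'.
    by apply: funext => j; rewrite /t /update; case: ifP.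
  apply: denote_update => // z w [p wp wl] zw.
  by exists p; rewrite zw // eq_sym.
have named_swap l x y :
    denote (named i2 i0 l) (t x y) <-> denote (named i2 i1 l) (t y x).
  have tswap x' y' : t y' x' \o tperm i0 i1 = t x' y' by exact: swapE.
  split; rewrite -tswap -denote_transp //.
    apply: denote_sub => //; first exact: admissible_transp.
    by move=> z [p /=]; rewrite tpermL tpermD 1?eq_sym // => zp zl; exists p.
  apply: denote_sub => //; first exact: admissible_transp.
  by move=> z [p /=]; rewrite tpermR tpermD 1?eq_sym // => zp zl; exists p.
have /choice[X XP] :
    forall l, exists x, forall y, denote (named i2 i0 l) (t x y).
  move=> l; have : cyl i0 (denote (named i2 i0 l)) (t (v i0) (v i0)).
    rewrite -denote_cyl //; apply: denote_sub (tF _ _) => //.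
      exact: admissible_cyl.
    move=> z; rewrite /frame_at /=; case E: (z.1 i2) => [p| |] // _.
    exists (update z.1 i0 (Vertex d (p l)), ord0) => [|j j0 /=].
      by exists p; rewrite /= ?update_same // update_other.
    by rewrite update_other.
  case=> u uN tu; exists (u i0) => y; apply: (named1 l _ (v i0)).
  rewrite (_ : t _ _ = u) //; apply: funext => j.
  have [->|j0] := eqVneq j i0; first by rewrite /t update_other // update_same.
  rewrite -(tu j) // /t; have [->|j1] := eqVneq j i1.
    by rewrite !update_same.
  by rewrite !update_other.
(* If x and y have the same label, then t x y carries this label at both i0 and
   i1, and these entries are equal in the algebra. *)
have functional l x y z :
    denote (named i2 i0 l) (t x z) -> denote (named i2 i0 l) (t y z) -> x = y.
  move=> xl yl; have : diag i0 i1 (t x y).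
    rewrite -denote_diag.
    have : denote (named i2 i0 l `&` named i2 i1 l) (t x y).
      rewrite denote_setI //; split; first exact: named1 xl.
      by apply/named_swap; apply: named1 yl.
    apply: denote_sub; [exact: admissible_setI|exact: admissible_diag|].
    move=> w [[p wp w0] [q wq w1]] /=; move: w0 w1; rewrite wp in wq.
    by case: wq => -> -> ->.
  by rewrite /diag /= /t update_same update_other // update_same.
have injX l l' : X l = X l' -> l = l'.
  move=> XX; apply: contrapT => ll.
  have : denote (named i2 i0 l `&` named i2 i0 l') (t (X l) (X l)).
    by rewrite denote_setI //; split; [exact: XP|rewrite XX; exact: XP].
  rewrite (_ : _ `&` _ = set0) ?denote_set0 //; apply/seteqP; split=> // w.
  case=> [[p wp w0] [q wq w1]]; apply: ll; rewrite wp in wq; case: wq => pq.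
  by move: w1; rewrite w0 -pq => -[/perm_inj].
have rV i x z : i2 != i ->
    denote (vertex_at i) (r x z) <-> denote (vertex_at i) (t x z).
  move=> i2i.
  have indep (z' w : atom) : vertex_at i w ->
      (forall j, j != i2 -> z'.1 j = w.1 j) -> vertex_at i z'.
    by move=> wV zw; rewrite /vertex_at /= zw // eq_sym.
  have rE : r x z = update (t x z) i2 (r x z i2).
    by apply: funext => j; rewrite [RHS]/update; case: eqVneq => [->//|/rt].
  have tE : t x z = update (r x z) i2 (t x z i2).
    by apply: funext => j; rewrite [RHS]/update; case: eqVneq => [->//|/rt].
  by split=> rtV; [rewrite tE|rewrite rE]; apply: denote_update rtV.
have vertexX l y :
    denote (vertex_at i0) (r (X l) y) /\ denote (vertex_at i1) (r y (X l)).
  split; apply/rV => //.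
    by apply: denote_sub (XP l y) => // w [p _]; rewrite /vertex_at /= => ->.
  have /named_swap := XP l y.
  by apply: denote_sub => // w [p _]; rewrite /vertex_at /= => ->.
(* X enumerates the represented vertices by labels; the colours become
   relations on labels. *)
pose S c l m := `[< denote (edge c) (r (X l) (X m)) >].
apply: (@no_odd_one_factorisation (k.*2).+1 S).
- by rewrite /= odd_double.
- move=> c; suff symS l m : S c l m -> S c m l.
    by move=> l m; apply/idP/idP; apply: symS.
  move=> /asboolP lm; apply/asboolP; rewrite -[r _ _](swapE v (X l) (X m)).
  rewrite -denote_transp //; apply: denote_sub lm => //.
    exact: admissible_transp.
  move=> w [pw w0 w1 wc]; split=> //=; rewrite ?tpermL ?tpermR //.
  apply: (@padded_edge_tperm _ i0 i1); rewrite -compA.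
  rewrite (_ : _ \o _ = w.1) //; apply: funext => j /=; by rewrite tpermK.
- move=> c l; apply/asboolP => ll.
  have : (~` diag i0 i1) (r (X l) (X l)).
    rewrite -denote_diag -denote_setC; last exact: admissible_diag.
    apply: denote_sub ll => //; first exact/admissible_setC/admissible_diag.
    by move=> w [[iw _ _] _ _ _] /= /iw.
  by apply; rewrite /diag /= /r update_same update_other // update_same.
- move=> c l.
  have [m lm] : exists m, m != l.
    have [->|l0] := eqVneq l ord0; first by exists ord_max.
    by exists ord0; rewrite eq_sym.
  have : cyl i1 (denote (edge c)) (r (X l) (X m)).
    rewrite -denote_cyl //.
    (* Being an edge of some colour is the same as consisting of two distinct
       vertices that replace those of an edge of colour 0; and every edge of
       some colour is in the cylindrification of each colour. *)
    pose A := cylinder i1 (cylinder i0 (edge ord0)).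
    have adA : admissible A by apply/admissible_cyl/admissible_cyl.
    have adD := admissible_setC (admissible_diag i0 i1).
    have : denote (((A `&` ~` [set x : atom | x.1 i0 = x.1 i1]) `&`
                    vertex_at i0) `&` vertex_at i1) (r (X l) (X m)).
      rewrite !denote_setI //; try by do ?apply: admissible_setI.
      split; last by have [] := vertexX m (X l).
      split; last by have [] := vertexX l (X m).
      split.
        rewrite denote_cyl; last exact: admissible_cyl.
        exists (update v i0 (X l)) => [|j j1]; last by rewrite /r update_other.
        rewrite denote_cyl //; exists v => // j j0; by rewrite update_other.
      rewrite denote_setC ?denote_diag; last exact: admissible_diag.
      rewrite /diag /= /r update_same update_other // update_same => /injX lm'.
      by rewrite lm' eqxx in lm.
    apply: denote_sub; first by do ?apply: admissible_setI.
      exact: admissible_cyl.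
    move=> w [[[[w' [z [pz z0 z1 _] w'z] ww'] w01] w0] w1].
    exists (w.1, c) => //; split=> //=.
    apply: (padded_edge_move pz z0 z1) => //.
    by move=> h h0 h1; rewrite ww' // w'z.
  case=> u uE ru; pose y := u i1.
  have uE' : u = r (X l) y.
    apply: funext => j; have [->|j1] := eqVneq j i1.
      by rewrite /r update_same.
    by rewrite -(ru j) // /r [LHS]update_other // [RHS]update_other.
  (* The other end of the edge of colour c is a vertex, hence has a label. *)
  have : denote (frame_at i2 `&` vertex_at i1) (t (X l) y).
    rewrite denote_setI //; split; first exact: tF.
    apply/rV; rewrite // -uE'; apply: denote_sub uE => //.
    by move=> w [].
  move=> /(denote_cover (F := named i2 i1)) [].
  + exact: admissible_setI.
  + by [].
  + move=> w [] /=; rewrite /frame_at /vertex_at /=.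
    case E: (w.1 i2) => [p| |] // _.
    case E' : (w.1 i1) => [|x|] // _; exists (p^-1 x)%g, p => //.
    by rewrite E' permKV.
  move=> m' ym'; exists m'; apply/asboolP.
  move/named_swap: ym' => /(functional _ _ _ _ (XP m' (X l))) ->.
  by rewrite -uE'.
- move=> c c' l m /asboolP lm /asboolP lm'; apply: contrapT => cc.
  have : denote (edge c `&` edge c') (r (X l) (X m)) by rewrite denote_setI.
  rewrite (_ : _ `&` _ = set0) ?denote_set0 //; apply/seteqP; split=> // w.
  by case=> -[_ _ _ wc] [_ _ _ wc']; apply: cc; rewrite -wc -wc'.
Qed.

End NonRepresentability.

Lemma split_algebra_not_representable :
  3 <= d -> ~ exists B : Pse d, isomorphic split_algebra (pse_algebra B).
Proof.
move=> d3 [B [phi /bij_inj phi_inj phi_hom]].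
apply: (@split_algebra_no_embedding d3 (pse_base B) (val \o phi)).
  by apply: (hom_comp phi_hom); apply: val_hom.
by move=> x y /val_inj/phi_inj.
Qed.

End Algebra.

Theorem theorem3 (alpha n : nat) (halpha : 3 <= alpha) :
  exists A : polyadic_type_algebra alpha,
    [/\ ~ (exists B : Pse alpha, isomorphic A (pse_algebra B)),
        forall (X : set A) (clX : op_closed X),
          n_generated n (subalgebra clX) ->
          exists B : Pse alpha, isomorphic (subalgebra clX) (pse_algebra B) &
        [/\ reduct_embeds_in_Pse (@cyl_free alpha) A,
            reduct_embeds_in_Pse (@diag_free alpha) A &
            reduct_embeds_in_Pse (@transp_free alpha) A]].
Proof.
have alpha0 : 0 < alpha by exact: leq_trans halpha.
exists (split_algebra alpha #|{ffun 'I_n * {set 'I_alpha} -> bool}|).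
split; first exact: split_algebra_not_representable.
  by move=> X clX; apply: n_generated_representable => //; apply: leqnSn.
split; first exact: cyl_free_representable.
  exact: diag_free_representable.
exact: transp_free_representable.
Qed.
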